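(* Let $\Bbbk$ be a field of prime characteristic $p$, let $a\in\Bbbk$, and let $\partial_a$ be the derivation of the nilHecke algebra $NH_n$ on $n$ strands over $\Bbbk$ with $\partial_a(x_i)=x_i^2$ and $\partial_a(\delta_i)=a-(a+1)x_i\delta_i+(a-1)x_{i+1}\delta_i$ on the generators. Then, for any parameter $a\in\Bbbk$, the equation $\partial_a^p=0$ holds on $NH_n$ if and only if $a\in\mathbb{F}_p$.
   Context: The nilHecke algebra $NH_n$ over $\Bbbk$ has generators $x_1,\dots,x_n$ and $\delta_1,\dots,\delta_{n-1}$ with relations: $x_ix_j=x_jx_i$; $\delta_i^2=0$; $\delta_i\delta_{i+1}\delta_i=\delta_{i+1}\delta_i\delta_{i+1}$; $\delta_i\delta_j=\delta_j\delta_i$ if $|i-j|>1$; $x_i\delta_j=\delta_jx_i$ if $i\ne j,j+1$; $x_i\delta_i-\delta_ix_{i+1}=1=\delta_ix_i-x_{i+1}\delta_i$. $\mathbb{F}_p\subset\Bbbk$ is the prime field.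
   Formalization: The number of strands is assumed to be at least 2; with n = 0 or 1 there is no δ generator, the parameter a does not occur and ∂_a^p = 0 always holds, so the ''only if'' part fails for a outside the prime field. *)

(* Defs.v *)
From HB Require Import structures.
From mathcomp Require Import all_boot all_order all_fingroup all_algebra.
From mathcomp Require Import generic_quotient.
From mathcomp.classical Require Import boolp.
From mathcomp Require Import ring zify.

Set Implicit Arguments.
Unset Strict Implicit.
Unset Printing Implicit Defensive.

Import GRing.Theory.
Local Open Scope ring_scope.
Local Open Scope quotient_scope.

(* Associative unital k-algebras given by generators and relations.           *)
(* alg_cong rel is the smallest congruence on formal expressions that         *)
(* contains rel and makes the quotient an associative unital k-algebra;       *)
(* presented_alg rel is that quotient.                                        *)

Inductive alg_expr (k G : Type) : Type :=
| EGen of G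
| EScal of k
| EAdd of alg_expr k G & alg_expr k G
| EMul of alg_expr k G & alg_expr k G.

Arguments EGen {k G}.
Arguments EScal {k G}.

HB.instance Definition _ (k G : Type) := gen_eqMixin (alg_expr k G).
HB.instance Definition _ (k G : Type) := gen_choiceMixin (alg_expr k G).

Inductive alg_cong (k : comNzRingType) (G : Type)
    (rel : alg_expr k G -> alg_expr k G -> Prop) :
    alg_expr k G -> alg_expr k G -> Prop :=
| cong_rel e f : rel e f -> alg_cong rel e f
| cong_refl e : alg_cong rel e e
| cong_sym e f : alg_cong rel e f -> alg_cong rel f e
| cong_trans e f g : alg_cong rel e f -> alg_cong rel f g -> alg_cong rel e g
| cong_add e e' f f' : alg_cong rel e e' -> alg_cong rel f f' ->
    alg_cong rel (EAdd e f) (EAdd e' f')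
| cong_mul e e' f f' : alg_cong rel e e' -> alg_cong rel f f' ->
    alg_cong rel (EMul e f) (EMul e' f')
| cong_addA e f g : alg_cong rel (EAdd e (EAdd f g)) (EAdd (EAdd e f) g)
| cong_addC e f : alg_cong rel (EAdd e f) (EAdd f e)
| cong_add0 e : alg_cong rel (EAdd (EScal 0) e) e
| cong_addN e : alg_cong rel (EAdd (EMul (EScal (- 1)) e) e) (EScal 0)
| cong_mulA e f g : alg_cong rel (EMul e (EMul f g)) (EMul (EMul e f) g)
| cong_mul1 e : alg_cong rel (EMul (EScal 1) e) e
| cong_mulDl e f g :
    alg_cong rel (EMul (EAdd e f) g) (EAdd (EMul e g) (EMul f g))
| cong_mulDr e f g :
    alg_cong rel (EMul e (EAdd f g)) (EAdd (EMul e f) (EMul e g))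
| cong_scalD c d : alg_cong rel (EScal (c + d)) (EAdd (EScal c) (EScal d))
| cong_scalM c d : alg_cong rel (EScal (c * d)) (EMul (EScal c) (EScal d))
| cong_scalC c e : alg_cong rel (EMul (EScal c) e) (EMul e (EScal c)).

Section Presented.
Variables (k : comNzRingType) (G : Type).
Variable rel : alg_expr k G -> alg_expr k G -> Prop.

Definition alg_eqv (e f : alg_expr k G) : bool := `[< alg_cong rel e f >].

Lemma alg_eqv_refl : reflexive alg_eqv.
Proof. by move=> e; apply/asboolP/cong_refl. Qed.

Lemma alg_eqv_sym : symmetric alg_eqv.
Proof. by move=> e f; apply/asboolP/asboolP; apply: cong_sym. Qed.

Lemma alg_eqv_trans : transitive alg_eqv.
Proof. by move=> f e g /asboolP ef /asboolP fg; apply/asboolP/(cong_trans ef). Qed.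

Canonical alg_eqv_equiv := EquivRel alg_eqv alg_eqv_refl alg_eqv_sym alg_eqv_trans.

Definition presented_alg := {eq_quot alg_eqv}.

HB.instance Definition _ := Choice.on presented_alg.

Definition alg_class (e : alg_expr k G) : presented_alg := \pi_{eq_quot alg_eqv} e.

Lemma alg_classP e f : alg_class e = alg_class f <-> alg_cong rel e f.
Proof.
split=> [/eqmodP /asboolP //|ef].
by apply/eqmodP/asboolP.
Qed.

Lemma alg_class_surj u : exists e, u = alg_class e.
Proof. by exists (repr u); rewrite /alg_class reprK. Qed.

Definition pres_add (u v : presented_alg) := alg_class (EAdd (repr u) (repr v)).
Definition pres_mul (u v : presented_alg) := alg_class (EMul (repr u) (repr v)).
Definition pres_scale (c : k) (u : presented_alg) :=
  alg_class (EMul (EScal c) (repr u)).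

Lemma cong_repr e : alg_cong rel (repr (alg_class e)) e.
Proof. by apply/alg_classP; rewrite /alg_class reprK. Qed.

Lemma pres_addE e f :
  pres_add (alg_class e) (alg_class f) = alg_class (EAdd e f).
Proof. by apply/alg_classP/cong_add; apply: cong_repr. Qed.

Lemma pres_mulE e f :
  pres_mul (alg_class e) (alg_class f) = alg_class (EMul e f).
Proof. by apply/alg_classP/cong_mul; apply: cong_repr. Qed.

Lemma pres_scaleE c e :
  pres_scale c (alg_class e) = alg_class (EMul (EScal c) e).
Proof. by apply/alg_classP/cong_mul; [apply: cong_refl | apply: cong_repr]. Qed.

Local Notation presE := (pres_addE, pres_mulE, pres_scaleE).

Lemma pres_addA : associative pres_add.
Proof.
move=> u v w; case: (alg_class_surj u) (alg_class_surj v) (alg_class_surj w).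
by move=> e -> [f ->] [g ->]; rewrite !presE; apply/alg_classP/cong_addA.
Qed.

Lemma pres_addC : commutative pres_add.
Proof.
move=> u v; case: (alg_class_surj u) (alg_class_surj v) => e -> [f ->].
by rewrite !presE; apply/alg_classP/cong_addC.
Qed.

Lemma pres_add0 : left_id (alg_class (EScal 0)) pres_add.
Proof.
move=> u; case: (alg_class_surj u) => e ->.
by rewrite !presE; apply/alg_classP/cong_add0.
Qed.

Lemma pres_addN : left_inverse (alg_class (EScal 0)) (pres_scale (- 1)) pres_add.
Proof.
move=> u; case: (alg_class_surj u) => e ->.
by rewrite !presE; apply/alg_classP/cong_addN.
Qed.

HB.instance Definition _ := GRing.isZmodule.Build presented_alg
  pres_addA pres_addC pres_add0 pres_addN.

Lemma pres_mulA : associative pres_mul.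
Proof.
move=> u v w; case: (alg_class_surj u) (alg_class_surj v) (alg_class_surj w).
by move=> e -> [f ->] [g ->]; rewrite !presE; apply/alg_classP/cong_mulA.
Qed.

Lemma pres_mul1l : left_id (alg_class (EScal 1)) pres_mul.
Proof.
move=> u; case: (alg_class_surj u) => e ->.
by rewrite !presE; apply/alg_classP/cong_mul1.
Qed.

Lemma pres_mul1r : right_id (alg_class (EScal 1)) pres_mul.
Proof.
move=> u; case: (alg_class_surj u) => e ->.
rewrite !presE; apply/alg_classP; apply: cong_trans (cong_mul1 _ _).
exact/cong_sym/cong_scalC.
Qed.

Lemma pres_mulDl : left_distributive pres_mul pres_add.
Proof.
move=> u v w; case: (alg_class_surj u) (alg_class_surj v) (alg_class_surj w).
by move=> e -> [f ->] [g ->]; rewrite !presE; apply/alg_classP/cong_mulDl.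
Qed.

Lemma pres_mulDr : right_distributive pres_mul pres_add.
Proof.
move=> u v w; case: (alg_class_surj u) (alg_class_surj v) (alg_class_surj w).
by move=> e -> [f ->] [g ->]; rewrite !presE; apply/alg_classP/cong_mulDr.
Qed.

HB.instance Definition _ := GRing.Zmodule_isPzRing.Build presented_alg
  pres_mulA pres_mul1l pres_mul1r pres_mulDl pres_mulDr.

Lemma pres_scaleA c d u :
  pres_scale c (pres_scale d u) = pres_scale (c * d) u.
Proof.
case: (alg_class_surj u) => e ->; rewrite !presE; apply/alg_classP.
apply: cong_trans (cong_mulA _ _ _ _) _.
by apply: cong_mul; [apply/cong_sym/cong_scalM | apply: cong_refl].
Qed.

Lemma pres_scale1 : left_id 1 pres_scale.
Proof.
move=> u; case: (alg_class_surj u) => e ->.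
by rewrite !presE; apply/alg_classP/cong_mul1.
Qed.

Lemma pres_scaleDr : right_distributive pres_scale +%R.
Proof.
move=> c u v; case: (alg_class_surj u) (alg_class_surj v) => e -> [f ->].
by rewrite /GRing.add /= !presE; apply/alg_classP/cong_mulDr.
Qed.

Lemma pres_scaleDl u : {morph pres_scale^~ u : c d / c + d}.
Proof.
move=> c d; case: (alg_class_surj u) => e ->.
rewrite [RHS]/GRing.add /= !presE; apply/alg_classP.
apply: cong_trans (cong_mulDl _ _ _ _).
by apply: cong_mul; [apply: cong_scalD | apply: cong_refl].
Qed.

HB.instance Definition _ := GRing.Zmodule_isLmodule.Build k presented_alg
  pres_scaleA pres_scale1 pres_scaleDr pres_scaleDl.

Lemma alg_classD e f : alg_class (EAdd e f) = alg_class e + alg_class f.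
Proof. by rewrite -pres_addE. Qed.

Lemma alg_classM e f : alg_class (EMul e f) = alg_class e * alg_class f.
Proof. by rewrite -pres_mulE. Qed.

Lemma alg_classS c : alg_class (EScal c) = c *: (1 : presented_alg).
Proof.
rewrite [RHS]pres_scaleE; apply/alg_classP.
apply: (cong_trans (cong_sym (cong_mul1 _ _))); exact/cong_sym/cong_scalC.
Qed.

Lemma pres_scalerAl (c : k) (u v : presented_alg) : c *: (u * v) = (c *: u) * v.
Proof.
case: (alg_class_surj u) (alg_class_surj v) => e -> [f ->].
rewrite -alg_classM [LHS]pres_scaleE [in RHS]/GRing.scale /= pres_scaleE.
by rewrite -alg_classM; apply/alg_classP/cong_mulA.
Qed.

Lemma pres_scalerAr (c : k) (u v : presented_alg) : c *: (u * v) = u * (c *: v).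
Proof.
case: (alg_class_surj u) (alg_class_surj v) => e -> [f ->].
rewrite -alg_classM [LHS]pres_scaleE [in RHS]/GRing.scale /= pres_scaleE.
rewrite -alg_classM; apply/alg_classP.
apply: cong_trans (cong_mulA _ _ _ _) _.
apply: cong_trans (cong_sym (cong_mulA _ _ _ _)).
by apply: cong_mul; [apply: cong_scalC | apply: cong_refl].
Qed.

End Presented.

Arguments presented_alg {k G} rel.
Arguments alg_class {k G} rel e.

(* The strands are 'I_n, numbered from 0; the crossing delta_i is indexed by  *)
(* i : 'I_n.-1 and involves the strands lstrand i = i and rstrand i = i + 1.  *)

Lemma lstrand_subproof n (i : 'I_n.-1) : (i < n)%N.
Proof. by case: n i => [|n] [i] //= /ltnW; rewrite ltnS. Qed.

Lemma rstrand_subproof n (i : 'I_n.-1) : (i.+1 < n)%N.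
Proof. by case: n i => [|n] [i]. Qed.

Definition lstrand n (i : 'I_n.-1) : 'I_n := Ordinal (lstrand_subproof i).
Definition rstrand n (i : 'I_n.-1) : 'I_n := Ordinal (rstrand_subproof i).

Section NilHeckeRelations.
Variables (k : comNzRingType) (n : nat).

Local Notation expr := (alg_expr k ('I_n + 'I_n.-1)).
Local Notation X i := (EGen (inl i) : expr).
Local Notation Delta i := (EGen (inr i) : expr).

Inductive nilHecke_rel : expr -> expr -> Prop :=
| rel_xx (i j : 'I_n) :
    nilHecke_rel (EMul (X i) (X j)) (EMul (X j) (X i))
| rel_delta2 (i : 'I_n.-1) :
    nilHecke_rel (EMul (Delta i) (Delta i)) (EScal 0)
| rel_braid (i j : 'I_n.-1) : j = i.+1 :> nat ->
    nilHecke_rel (EMul (EMul (Delta i) (Delta j)) (Delta i))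
                 (EMul (EMul (Delta j) (Delta i)) (Delta j))
| rel_deltaC (i j : 'I_n.-1) : (i.+1 < j)%N ->
    nilHecke_rel (EMul (Delta i) (Delta j)) (EMul (Delta j) (Delta i))
| rel_xdeltaC (i : 'I_n) (j : 'I_n.-1) : i != lstrand j -> i != rstrand j ->
    nilHecke_rel (EMul (X i) (Delta j)) (EMul (Delta j) (X i))
| rel_xdelta (i : 'I_n.-1) :
    nilHecke_rel (EMul (X (lstrand i)) (Delta i))
                 (EAdd (EMul (Delta i) (X (rstrand i))) (EScal 1))
| rel_deltax (i : 'I_n.-1) :
    nilHecke_rel (EMul (Delta i) (X (lstrand i)))
                 (EAdd (EMul (X (rstrand i)) (Delta i)) (EScal 1)).

End NilHeckeRelations.

Definition nilHecke (k : fieldType) (n : nat) : Type :=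
  presented_alg (@nilHecke_rel k n).

HB.instance Definition _ (k : fieldType) (n : nat) :=
  GRing.PzRing.on (nilHecke k n).
HB.instance Definition _ (k : fieldType) (n : nat) :=
  GRing.Lmodule.on (nilHecke k n).

(* NH_n acts on functions of n pairwise distinct variables: x_i multiplies by *)
(* the i-th variable and delta_i is the divided difference operator.  Only    *)
(* used to see that NH_n is not the zero ring.                                *)
Section DividedDifferences.
Variables (k L : fieldType) (iota : {rmorphism k -> L}) (n : nat).

Local Notation expr := (alg_expr k ('I_n + 'I_n.-1)).
Local Notation point := ('I_n -> L).

Definition swap_strands (j : 'I_n.-1) (z : point) : point :=
  z \o tperm (lstrand j) (rstrand j).

Fixpoint dd_act (e : expr) (f : point -> L) (z : point) {struct e} : L :=
  match e with
  | EGen (inl i) => z i * f z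
  | EGen (inr j) => (f z - f (swap_strands j z)) / (z (lstrand j) - z (rstrand j))
  | EScal c => iota c * f z
  | EAdd e1 e2 => dd_act e1 f z + dd_act e2 f z
  | EMul e1 e2 => dd_act e1 (dd_act e2 f) z
  end.

Lemma swap_strands_inj j z : injective z -> injective (swap_strands j z).
Proof. by move=> z_inj; apply: inj_comp => //; apply: perm_inj. Qed.

Lemma swap_strandsK j z : swap_strands j (swap_strands j z) = z.
Proof. by apply/funext=> i; rewrite /swap_strands /= tpermK. Qed.

Lemma lrstrand_neq (j : 'I_n.-1) : lstrand j != rstrand j.
Proof. by rewrite -val_eqE /= neq_ltn ltnSn. Qed.

Lemma swap_strands_l j z : swap_strands j z (lstrand j) = z (rstrand j).
Proof. by rewrite /swap_strands /= tpermL. Qed.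

Lemma swap_strands_r j z : swap_strands j z (rstrand j) = z (lstrand j).
Proof. by rewrite /swap_strands /= tpermR. Qed.

Lemma swap_strands_id j z i : i != lstrand j -> i != rstrand j ->
  swap_strands j z i = z i.
Proof. by move=> ? ?; rewrite /swap_strands /= tpermD // eq_sym. Qed.

Lemma swap_strands_braid (i j : 'I_n.-1) z : j = i.+1 :> nat ->
  swap_strands i (swap_strands j (swap_strands i z)) =
  swap_strands j (swap_strands i (swap_strands j z)).
Proof.
move=> ij; apply/funext=> m; rewrite /swap_strands /=; congr z.
have e : rstrand i = lstrand j by apply: val_inj; rewrite /= ij.
have ne : lstrand i != rstrand j by rewrite -val_eqE /= ij; lia.
have := lrstrand_neq i; have := lrstrand_neq j; rewrite -e.
move: (lstrand i) (rstrand i) (rstrand j) ne => a b c ac bc ab.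
suff E : (tperm a b * tperm b c * tperm a b = tperm b c * tperm a b * tperm b c)%g.
  by have := congr1 (fun s : {perm _} => s m) E; rewrite !permM.
have -> : (tperm a b * tperm b c * tperm a b = tperm b c ^ tperm a b)%g.
  by rewrite /conjg tpermV mulgA.
have -> : (tperm b c * tperm a b * tperm b c = tperm a b ^ tperm b c)%g.
  by rewrite /conjg tpermV mulgA.
rewrite !tpermJ !(tpermL, tpermR) (tpermD (z := a)) 1?eq_sym //.
by rewrite ?tpermD // eq_sym.
Qed.

Lemma dd_act_ext e f g : (forall z, injective z -> f z = g z) ->
  forall z, injective z -> dd_act e f z = dd_act e g z.
Proof.
elim: e f g => [[i|j]|c|e1 IH1 e2 IH2|e1 IH1 e2 IH2] f g fg z z_inj //=.
- by rewrite fg.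
- by rewrite !fg //; apply: swap_strands_inj.
- by rewrite fg.
- by rewrite (IH1 f g) // (IH2 f g).
- by apply: IH1 => // y y_inj; apply: IH2.
Qed.

Lemma dd_actD e f g z :
  dd_act e (fun y => f y + g y) z = dd_act e f z + dd_act e g z.
Proof.
elim: e f g z => [[i|j]|c|e1 IH1 e2 IH2|e1 IH1 e2 IH2] f g z //=.
- by rewrite mulrDr.
- by rewrite -mulrDl; congr (_ / _); ring.
- by rewrite mulrDr.
- by rewrite IH1 IH2 addrACA.
- have -> : dd_act e2 (fun y => f y + g y) =
            (fun y => dd_act e2 f y + dd_act e2 g y).
    by apply/funext=> y; apply: IH2.
  exact: IH1.
Qed.

Lemma dd_actZ e c f z :
  dd_act e (fun y => iota c * f y) z = iota c * dd_act e f z.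
Proof.
elim: e f z => [[i|j]|d|e1 IH1 e2 IH2|e1 IH1 e2 IH2] f z /=.
- by rewrite mulrCA.
- by rewrite -mulrBr mulrA.
- by rewrite mulrCA.
- by rewrite IH1 IH2 mulrDr.
- have -> : dd_act e2 (fun y => iota c * f y) = (fun y => iota c * dd_act e2 f y).
    by apply/funext=> y; apply: IH2.
  exact: IH1.
Qed.

Lemma dd_act_rel e1 e2 : nilHecke_rel e1 e2 ->
  forall f z, injective z -> dd_act e1 f z = dd_act e2 f z.
Proof.
have dn (j : 'I_n.-1) (y : point) : injective y -> y (lstrand j) - y (rstrand j) != 0.
  by move=> y_inj; rewrite subr_eq0 (inj_eq y_inj) lrstrand_neq.
case=> [i j|i|i j ij|i j ij|i j il ir|i|i] f z z_inj /=.
- by rewrite mulrCA.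
- rewrite swap_strandsK swap_strands_l swap_strands_r rmorph0 mul0r.
  have := dn i z z_inj; set a := z _; set b := z _ => ab.
  have ba : b - a != 0 by rewrite -opprB oppr_eq0.
  by field; rewrite ab ba.
- have e : rstrand i = lstrand j by apply: val_inj; rewrite /= ij.
  have ne : lstrand i != rstrand j by rewrite -val_eqE /= ij; lia.
  have jl y : swap_strands j y (lstrand i) = y (lstrand i).
    by rewrite swap_strands_id // -e lrstrand_neq.
  have jm y : swap_strands j y (rstrand i) = y (rstrand j).
    by rewrite e swap_strands_l.
  have jr y : swap_strands j y (rstrand j) = y (rstrand i).
    by rewrite e swap_strands_r.
  have ir y : swap_strands i y (rstrand j) = y (rstrand j).
    by rewrite swap_strands_id 1?eq_sym // e lrstrand_neq.
  have ab := dn i z z_inj; have bc := dn j z z_inj; rewrite -e in bc *.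
  have ac : z (lstrand i) - z (rstrand j) != 0.
    by rewrite subr_eq0 (inj_eq z_inj).
  rewrite !(swap_strands_l, swap_strands_r, swap_strandsK, jl, jm, jr, ir).
  rewrite swap_strands_braid // -?e.
  have opp (u v : L) : u - v != 0 -> v - u != 0 by rewrite -opprB oppr_eq0.
  by field; rewrite ?(ab, bc, ac, opp _ _ ab, opp _ _ bc, opp _ _ ac).
- have [ll lr rl rr] : [/\ lstrand j != lstrand i, lstrand j != rstrand i,
      rstrand j != lstrand i & rstrand j != rstrand i].
    by split; rewrite -val_eqE /=; lia.
  have jl y : swap_strands j y (lstrand i) = y (lstrand i).
    by rewrite swap_strands_id // eq_sym.
  have jr y : swap_strands j y (rstrand i) = y (rstrand i).
    by rewrite swap_strands_id // eq_sym.
  have il y : swap_strands i y (lstrand j) = y (lstrand j).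
    by rewrite swap_strands_id.
  have ir y : swap_strands i y (rstrand j) = y (rstrand j).
    by rewrite swap_strands_id.
  have -> : swap_strands i (swap_strands j z) = swap_strands j (swap_strands i z).
    apply/funext=> m; rewrite /swap_strands /= -!permM; congr (z (fun_of_perm _ m)).
    by rewrite [RHS]conjgC tpermJ !tpermD // eq_sym.
  by rewrite !(jl, jr, il, ir); field; rewrite !dn.
- by rewrite swap_strands_id // -mulrBr mulrA.
- rewrite swap_strands_r rmorph1 mul1r.
  by have := dn i z z_inj => ab; field.
- rewrite swap_strands_l rmorph1 mul1r.
  by have := dn i z z_inj => ab; field.
Qed.

Lemma dd_act_cong e1 e2 : alg_cong (@nilHecke_rel k n) e1 e2 ->
  forall f z, injective z -> dd_act e1 f z = dd_act e2 f z.
Proof.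
elim=> {e1 e2} [e f ef|e|e f _ IH|e f g _ IH1 _ IH2|e e' f f' _ IHe _ IHf
  |e e' f f' _ IHe _ IHf|e f g|e f|e|e|e f g|e|e f g|e f g|c d|c d|c e]
  h z z_inj //=; rewrite ?rmorphD ?rmorphM ?rmorphN ?rmorph0 ?rmorph1.
- exact: dd_act_rel.
- by rewrite IH.
- by rewrite IH1 ?IH2.
- by rewrite IHe ?IHf.
- by rewrite IHe //; apply: dd_act_ext (IHf h) _ z_inj.
- by rewrite addrA.
- by rewrite addrC.
- by rewrite mul0r add0r.
- by rewrite mulN1r addNr mul0r.
- by rewrite mul1r.
- exact: dd_actD.
- by rewrite mulrDl.
- by rewrite mulrA.
- by rewrite dd_actZ.
Qed.

End DividedDifferences.

Lemma nilHecke_oner_neq0 (k : fieldType) (n : nat) : 1 != 0 :> nilHecke k n.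
Proof.
apply/eqP=> /alg_classP one_zero.
pose iota : {rmorphism k -> {fraction {poly k}}} := @tofrac {poly k} \o polyC.
pose z (i : 'I_n) : {fraction {poly k}} := tofrac ('X^i : {poly k}).
have z_inj : injective z.
  move=> i j /eqP; rewrite tofrac_eq => /eqP/(congr1 (fun p : {poly k} => size p)).
  by rewrite !size_polyXn => -[] /val_inj.
have := dd_act_cong iota one_zero (fun=> 1) z_inj.
by rewrite /= rmorph0 rmorph1 mul0r mul1r => /eqP; rewrite oner_eq0.
Qed.

HB.instance Definition _ (k : fieldType) (n : nat) :=
  GRing.PzSemiRing_isNonZero.Build (nilHecke k n) (nilHecke_oner_neq0 k n).
HB.instance Definition _ (k : fieldType) (n : nat) :=
  GRing.LSemiModule_isLSemiAlgebra.Build k (nilHecke k n)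
    (@pres_scalerAl k _ (@nilHecke_rel k n)).
HB.instance Definition _ (k : fieldType) (n : nat) :=
  GRing.LSemiAlgebra_isSemiAlgebra.Build k (nilHecke k n)
    (@pres_scalerAr k _ (@nilHecke_rel k n)).

Definition nh_x {k : fieldType} {n : nat} (i : 'I_n) : nilHecke k n :=
  alg_class (@nilHecke_rel k n) (EGen (inl i)).
Definition nh_delta {k : fieldType} {n : nat} (i : 'I_n.-1) : nilHecke k n :=
  alg_class (@nilHecke_rel k n) (EGen (inr i)).

Section NilHeckeTheory.
Variables (k : fieldType) (n : nat).
Implicit Types u v : nilHecke k n.
Local Notation x := (@nh_x k n).
Local Notation delta := (@nh_delta k n).

Lemma nilHecke_ind (P : nilHecke k n -> Prop) :
  (forall i, P (x i)) -> (forall i, P (delta i)) -> (forall c : k, P c%:A) ->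
  (forall u v, P u -> P v -> P (u + v)) ->
  (forall u v, P u -> P v -> P (u * v)) -> forall u, P u.
Proof.
move=> Px Pdelta Pscal Padd Pmul u; have [e ->] := alg_class_surj u.
elim: e => [[i|i]|c|e IHe f IHf|e IHe f IHf].
- exact: Px.
- exact: Pdelta.
- by rewrite alg_classS; apply: Pscal.
- by rewrite alg_classD; apply: Padd.
- by rewrite alg_classM; apply: Pmul.
Qed.

Lemma nh_xx i j : x i * x j = x j * x i.
Proof. by rewrite -!alg_classM; apply/alg_classP/cong_rel; apply: rel_xx. Qed.

Lemma nh_delta2 i : delta i * delta i = 0.
Proof. by rewrite -!alg_classM; apply/alg_classP/cong_rel; apply: rel_delta2. Qed.

Lemma nh_braid (i j : 'I_n.-1) : j = i.+1 :> nat ->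
  delta i * delta j * delta i = delta j * delta i * delta j.
Proof.
move=> ij; rewrite -[delta i * delta j]alg_classM -[delta j * delta i]alg_classM.
by rewrite -!alg_classM; apply/alg_classP/cong_rel; apply: rel_braid.
Qed.

Lemma nh_deltaC (i j : 'I_n.-1) : (i.+1 < j)%N ->
  delta i * delta j = delta j * delta i.
Proof. by move=> ij; rewrite -!alg_classM; apply/alg_classP/cong_rel; apply: rel_deltaC. Qed.

Lemma nh_xdeltaC i j : i != lstrand j -> i != rstrand j ->
  x i * delta j = delta j * x i.
Proof.
by move=> il ir; rewrite -!alg_classM; apply/alg_classP/cong_rel; apply: rel_xdeltaC.
Qed.

Lemma nh_xdelta i : x (lstrand i) * delta i - delta i * x (rstrand i) = 1.
Proof.
apply/eqP; rewrite subr_eq addrC -[1]scale1r -alg_classS -!alg_classM -alg_classD.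
apply/eqP/alg_classP/cong_rel; apply: rel_xdelta.
Qed.

Lemma nh_deltax i : delta i * x (lstrand i) - x (rstrand i) * delta i = 1.
Proof.
apply/eqP; rewrite subr_eq addrC -[1]scale1r -alg_classS -!alg_classM -alg_classD.
apply/eqP/alg_classP/cong_rel; apply: rel_deltax.
Qed.

End NilHeckeTheory.

Arguments nh_xx {k n} i j.
Arguments nh_delta2 {k n} i.
Arguments nh_braid {k n} i j.
Arguments nh_deltaC {k n} i j.
Arguments nh_xdeltaC {k n} i j.
Arguments nh_xdelta {k n} i.
Arguments nh_deltax {k n} i.

(* A decision procedure for equations in abelian groups. *)
Inductive zexp : Type := ZVar of nat | ZZero | ZAdd of zexp & zexp | ZOpp of zexp.

Fixpoint zeval (V : zmodType) (env : seq V) (e : zexp) : V :=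
  match e with
  | ZVar i => env`_i
  | ZZero => 0
  | ZAdd e f => zeval env e + zeval env f
  | ZOpp e => - zeval env e
  end.

Fixpoint zcoef (e : zexp) (i : nat) : int :=
  match e with
  | ZVar j => (i == j)%:Z
  | ZZero => 0
  | ZAdd e f => zcoef e i + zcoef f i
  | ZOpp e => - zcoef e i
  end.

Lemma zeval_sum (V : zmodType) (env : seq V) e :
  zeval env e = \sum_(i < size env) env`_i *~ zcoef e i.
Proof.
elim: e => [j||e IHe f IHf|e IHe] /=.
- have [j_lt|j_ge] := ltnP j (size env).
    rewrite (bigD1 (Ordinal j_lt)) //= eqxx mulr1z big1 ?addr0 // => i.
    by rewrite -val_eqE /= => /negPf ->; rewrite mulr0z.
  rewrite nth_default // big1 // => i _; rewrite ltn_eqF ?mulr0z //.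
  exact: leq_trans (ltn_ord i) j_ge.
- by rewrite big1.
- by rewrite IHe IHf -big_split; apply: eq_bigr => i _; rewrite mulrzDr.
- by rewrite IHe -sumrN; apply: eq_bigr => i _; rewrite mulrNz.
Qed.

Lemma zeval_eq (V : zmodType) (env : seq V) e f :
  all (fun i => zcoef e i == zcoef f i) (iota 0 (size env)) ->
  zeval env e = zeval env f.
Proof.
move=> /allP ef; rewrite !zeval_sum; apply: eq_bigr => i _.
by rewrite (eqP (ef i _)) // mem_iota /= add0n.
Qed.

Ltac zmod_index u env :=
  match env with
  | ?v :: _ => let _ := match constr:(O) with _ => unify u v end in constr:(O)
  | _ :: ?env' => let i := zmod_index u env' in constr:(S i)
  end.

Ltac zmod_env V u env :=
  lazymatch u with
  | @GRing.add _ ?v ?w => let env1 := zmod_env V v env in zmod_env V w env1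
  | @GRing.opp _ ?v => zmod_env V v env
  | @GRing.zero _ => env
  | _ => match constr:(O) with
         | _ => let _ := zmod_index u env in env
         | _ => constr:(u :: env)
         end
  end.

Ltac zmod_quote u env :=
  lazymatch u with
  | @GRing.add _ ?v ?w =>
    let e := zmod_quote v env in let f := zmod_quote w env in constr:(ZAdd e f)
  | @GRing.opp _ ?v => let e := zmod_quote v env in constr:(ZOpp e)
  | @GRing.zero _ => constr:(ZZero)
  | _ => let i := zmod_index u env in constr:(ZVar i)
  end.

Ltac zmod_eq :=
  lazymatch goal with
  | |- @eq ?V ?u ?v =>
    let env1 := zmod_env V u (@nil V) in
    let env := zmod_env V v env1 in
    let e := zmod_quote u env in
    let f := zmod_quote v env in
    apply: (@zeval_eq _ env e f); vm_compute; reflexivity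
  end.

(* In any algebra, the prescribed values on generators are compatible with    *)
(* the relations of NH_n; hence the derivation of NH_n exists for every a.    *)
Section DerivationRelations.
Variables (k : fieldType) (A : algType k) (a : k).
Implicit Types x y d : A.

Definition nh_der_delta x y d : A :=
  a%:A - (a + 1) *: (x * d) + (a - 1) *: (y * d).

Let scaleAl := fun c (u v : A) => esym (scalerAl c u v).
Let scaleAr := fun c (u v : A) => esym (scalerAr c u v).
Let mulA := fun u v w : A => esym (mulrA u v w).
Let expand :=
  (@mulrDl A, @mulrDr A, @mulNr A, @mulrN A, @opprD A, @opprK A, @mulr1 A,
   @mul1r A, @mulr0 A, @mul0r A, @scalerDl k A, @scaleNr k A, @scalerDr k A,
   @scalerN k A, @scale1r k A, @scaler0 k A, scaleAl, scaleAr, mulA, @oppr0 A,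
   @addr0 A, @add0r A, @subr0 A, @sub0r A).

Lemma comm_nh_der_delta x y d w :
  GRing.comm w x -> GRing.comm w y -> GRing.comm w d ->
  GRing.comm w (nh_der_delta x y d).
Proof.
move=> wx wy wd.
have wZ c u : GRing.comm w u -> GRing.comm w (c *: u).
  by move=> wu; rewrite /GRing.comm -scalerAl -scalerAr wu.
apply: commrD; first apply: commrB.
- exact/wZ/commr1.
- exact/wZ/commrM.
- exact/wZ/commrM.
Qed.

Section OneCrossing.
Variables x y d : A.
Hypothesis xy : y * x = x * y.
Hypothesis dd : d * d = 0.
Hypothesis dx : d * x = 1 + y * d.
Hypothesis dy : d * y = x * d - 1.

Let dxw w : d * (x * w) = w + y * (d * w).
Proof. by rewrite mulrA dx mulrDl mul1r mulrA. Qed.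
Let dyw w : d * (y * w) = x * (d * w) - w.
Proof. by rewrite mulrA dy mulrDl mulNr mul1r mulrA. Qed.
Let yxw w : y * (x * w) = x * (y * w).
Proof. by rewrite mulrA xy mulrA. Qed.
Let push := (xy, dd, dx, dy, dxw, dyw, yxw, expand).

Lemma nh_der_dd : nh_der_delta x y d * d + d * nh_der_delta x y d = 0.
Proof. by rewrite /nh_der_delta !push; zmod_eq. Qed.

Lemma nh_der_xd : x ^+ 2 * d + x * nh_der_delta x y d =
  nh_der_delta x y d * y + d * y ^+ 2.
Proof. by rewrite /nh_der_delta !expr2 !push; zmod_eq. Qed.

Lemma nh_der_dx : nh_der_delta x y d * x + d * x ^+ 2 =
  y ^+ 2 * d + y * nh_der_delta x y d.
Proof. by rewrite /nh_der_delta !expr2 !push; zmod_eq. Qed.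

End OneCrossing.

Lemma nh_der_braid x y z d e :
  y * x = x * y -> z * x = x * z -> z * y = y * z -> d * d = 0 -> e * e = 0 ->
  d * x = 1 + y * d -> d * y = x * d - 1 -> d * z = z * d ->
  e * y = 1 + z * e -> e * z = y * e - 1 -> e * x = x * e ->
  e * (d * e) = d * (e * d) ->
  (nh_der_delta x y d * e + d * nh_der_delta y z e) * d +
    d * e * nh_der_delta x y d =
  (nh_der_delta y z e * d + e * nh_der_delta x y d) * e +
    e * d * nh_der_delta y z e.
Proof.
move=> yx zx zy dd ee dx dy dz ey ez ex ede.
have lift (u v w : A) : u * v = w -> forall m, u * (v * m) = w * m.
  by move=> <- m; rewrite mulrA.
have := (lift _ _ _ yx, lift _ _ _ zx, lift _ _ _ zy).
have := (lift _ _ _ dx, lift _ _ _ dy, lift _ _ _ dz).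
have := (lift _ _ _ ex, lift _ _ _ ey, lift _ _ _ ez).
have := (lift _ _ _ dd, lift _ _ _ ee) => l1 l2 l3 l4.
rewrite /nh_der_delta.
rewrite !(expand, yx, zx, zy, dd, ee, dx, dy, dz, ey, ez, ex, ede, l1, l2, l3, l4).
zmod_eq.
Qed.

End DerivationRelations.

Section NilHeckeDerivation.
Variables (k : fieldType) (n : nat) (a : k).
Local Notation NH := (nilHecke k n).
Local Notation rel := (@nilHecke_rel k n).
Local Notation cls e := (alg_class rel e : NH).
Local Notation x := (@nh_x k n).
Local Notation delta := (@nh_delta k n).

Fixpoint nh_der_expr (e : alg_expr k ('I_n + 'I_n.-1)) : NH :=
  match e with
  | EGen (inl i) => x i ^+ 2
  | EGen (inr i) => nh_der_delta a (x (lstrand i)) (x (rstrand i)) (delta i)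
  | EScal _ => 0
  | EAdd e f => nh_der_expr e + nh_der_expr f
  | EMul e f => nh_der_expr e * cls f + cls e * nh_der_expr f
  end.

Lemma nh_clsD e f : cls (EAdd e f) = cls e + cls f.
Proof. exact: alg_classD. Qed.

Lemma nh_clsM e f : cls (EMul e f) = cls e * cls f.
Proof. exact: alg_classM. Qed.

Lemma nh_clsS c : cls (EScal c) = c%:A.
Proof. exact: alg_classS. Qed.

Lemma nh_delta_xl i : delta i * x (lstrand i) = 1 + x (rstrand i) * delta i.
Proof. by apply/eqP; rewrite -subr_eq nh_deltax. Qed.

Lemma nh_delta_xr i : delta i * x (rstrand i) = x (lstrand i) * delta i - 1.
Proof. by rewrite -(nh_xdelta i) opprB addrC subrK. Qed.

Lemma nh_der_rel e f : rel e f -> nh_der_expr e = nh_der_expr f.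
Proof.
have far (i j : 'I_n.-1) : (i.+1 < j)%N ->
    [/\ lstrand i != lstrand j, lstrand i != rstrand j,
        rstrand i != lstrand j & rstrand i != rstrand j].
  by split; rewrite -val_eqE /=; lia.
case=> [i j|i|i j ij|i j ij|i j il ir|i|i] /=.
- have xij : GRing.comm (x i) (x j) by apply: nh_xx.
  by rewrite addrC (commrX 2 xij) (commrX 2 (commr_sym xij)).
- by apply: nh_der_dd; rewrite ?nh_delta_xl ?nh_delta_xr ?nh_delta2 //; apply: nh_xx.
- have e' : rstrand i = lstrand j by apply: val_inj; rewrite /= ij.
  rewrite !nh_clsM -e'; apply: nh_der_braid; try exact: nh_xx.
  + exact: nh_delta2.
  + exact: nh_delta2.
  + exact: nh_delta_xl.
  + exact: nh_delta_xr.
  + by rewrite nh_xdeltaC // -val_eqE /= ij; lia.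
  + by rewrite e' nh_delta_xl.
  + by rewrite e' nh_delta_xr.
  + by rewrite nh_xdeltaC // -val_eqE /= ij; lia.
  + by rewrite !mulrA -nh_braid.
- have [ll lr rl rr] := far _ _ ij.
  rewrite addrC; congr (_ + _).
    apply: comm_nh_der_delta; last exact: nh_deltaC.
      by apply: commr_sym; apply: nh_xdeltaC; rewrite eq_sym.
    by apply: commr_sym; apply: nh_xdeltaC; rewrite eq_sym.
  symmetry; apply: comm_nh_der_delta; last exact/commr_sym/nh_deltaC.
    by apply: commr_sym; apply: nh_xdeltaC.
  by apply: commr_sym; apply: nh_xdeltaC.
- rewrite addrC; congr (_ + _).
    by apply: comm_nh_der_delta; [apply: nh_xx | apply: nh_xx | apply: nh_xdeltaC].
  symmetry; apply: commrX; apply: commr_sym; exact: nh_xdeltaC.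
- rewrite addr0; apply: nh_der_xd; [exact: nh_xx | exact: nh_delta_xr].
- rewrite addr0; apply: nh_der_dx; [exact: nh_xx | exact: nh_delta_xl].
Qed.

Lemma nh_der_cong e f : alg_cong rel e f -> nh_der_expr e = nh_der_expr f.
Proof.
elim=> {e f} [e f|e|e f _ -> //|e f g _ -> _ -> //|e e' f f' _ IHe _ IHf
  |e e' f f' /alg_classP ee' IHe /alg_classP ff' IHf|e f g|e f|e|e|e f g|e
  |e f g|e f g|c d|c d|c e] //=.
- exact: nh_der_rel.
- by rewrite IHe IHf.
- by rewrite IHe IHf ee' ff'.
- by rewrite addrA.
- by rewrite addrC.
- by rewrite add0r.
- by rewrite mul0r add0r nh_clsS scaleN1r mulN1r addNr.
- by rewrite !nh_clsM mulrDr mulrDl !mulrA addrA.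
- by rewrite nh_clsS scale1r mul0r mul1r add0r.
- by rewrite nh_clsD mulrDl mulrDl addrACA.
- by rewrite nh_clsD mulrDr mulrDr addrACA.
- by rewrite addr0.
- by rewrite mul0r mulr0 addr0.
- by rewrite mul0r mulr0 add0r addr0 nh_clsS -scalerAl -scalerAr mul1r mulr1.
Qed.

Definition nh_der (u : NH) : NH := nh_der_expr (repr u).

Lemma nh_derE e : nh_der (cls e) = nh_der_expr e.
Proof. exact/nh_der_cong/cong_repr. Qed.

Lemma nh_der_linear : linear nh_der.
Proof.
move=> c u v; have [e ->] := alg_class_surj u; have [f ->] := alg_class_surj v.
have -> : c *: cls e + cls f = cls (EAdd (EMul (EScal c) e) f).
  by rewrite nh_clsD nh_clsM nh_clsS -scalerAl mul1r.
by rewrite !nh_derE /= nh_clsS mul0r add0r -scalerAl mul1r.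
Qed.

HB.instance Definition _ := GRing.isLinear.Build k NH NH *:%R nh_der nh_der_linear.

Lemma nh_der_leibniz u v : nh_der (u * v) = nh_der u * v + u * nh_der v.
Proof.
have [e ->] := alg_class_surj u; have [f ->] := alg_class_surj v.
by rewrite -[cls e * cls f]nh_clsM !nh_derE.
Qed.

Lemma nilHecke_derivation_exists : exists D : {linear NH -> NH},
  [/\ forall u v, D (u * v) = D u * v + u * D v,
      forall i, D (x i) = x i ^+ 2
    & forall i, D (delta i) = a%:A - (a + 1) *: (x (lstrand i) * delta i)
                              + (a - 1) *: (x (rstrand i) * delta i)].
Proof.
exists (nh_der : {linear NH -> NH}).
by split=> [u v|i|i]; [apply: nh_der_leibniz | apply: nh_derE | apply: nh_derE].
Qed.

End NilHeckeDerivation.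

(* Main.v *)
Require Import Defs.
From mathcomp Require Import all_boot all_order all_fingroup all_algebra.
From mathcomp Require Import generic_quotient.

Set Implicit Arguments.
Unset Strict Implicit.
Unset Printing Implicit Defensive.

Import GRing.Theory.
Local Open Scope ring_scope.

(** Write E for the p-th power of the derivation D.  In characteristic p, the
    Leibniz formula for D^p leaves only its two extreme terms, so E is again a
    derivation, and E = 0 exactly when E kills the generators.

    Fix a crossing d = delta_i on the strands x = x_i and y = x_(i+1), and put
    w = x d.  The prescribed value of D d and the relation x d = d y + 1 give
      D w = (a - 1) y w - a w y.
    Multiplications by y on the left and on the right commute, and D y = y^2;
    so D^m w is computed as if w were a product of two elements that are
    multiplied under D by (a - 1) y and - a y.  The same binomial formula gives
      E w = prod_(j < p) (j + a - 1) y^p w + prod_(j < p) (j - a) w y^p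
    ([iter_derivation_eigen]), and x_i itself is the case D x = x x, for which
    both products vanish.  A product prod_(j < p) (j + c) is zero if and only if
    c lies in the prime field ([prod_natD_eq0]).

    If a lies in F_p, then E x = E y = E w = 0.  Since d = d w, applying E gives
    E d = (E d) w = y (E d) d; substituting this in itself gives E d = 0, because
    d^2 = 0.  Conversely, if E = 0, let E w act on the constant function 1 by
    divided differences.  As d 1 = 0 and d (y^p) = (y^p - x^p) / (x - y) is not
    zero, the product prod_(j < p) (j - a) must vanish, that is, a lies in F_p. *)

(** * The prime field *)

Section PrimeField.
Variables (k : fieldType) (p : nat).
Hypothesis char_k : p \in [pchar k].

Lemma prime_subfieldP (c : k) :
  (exists i : 'F_p, c = (i : nat)%:R) <-> (exists m : nat, c = m%:R).
Proof.
split=> [[i ->]|[m ->]]; first by exists i.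
exists (m%:R : 'F_p); rewrite val_Fp_nat ?(pcharf_prime char_k) //.
by rewrite (GRing.natr_mod_pchar char_k).
Qed.

Lemma oppr_nat_pchar m : - m%:R = (p.-1 * m)%:R :> k.
Proof.
apply/eqP; rewrite eq_sym -addr_eq0 -natrD -mulSnr.
by rewrite prednK ?prime_gt0 ?(pcharf_prime char_k) // natrM (pcharf0 char_k) mul0r.
Qed.

(** The factors run over the translate by c of the prime field, which contains 0
    if and only if - c, hence c, lies in the prime field. *)
Lemma prod_natD_eq0 (c : k) :
  \prod_(j < p) (j%:R + c) = 0 <-> exists m : nat, c = m%:R.
Proof.
split=> [/eqP/prodf_eq0[j _]|[m ->]].
  by rewrite addrC addr_eq0 => /eqP->; exists (p.-1 * j)%N; apply: oppr_nat_pchar.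
have p_gt0 : (0 < p)%N by rewrite prime_gt0 ?(pcharf_prime char_k).
(* The vanishing factor has index - m modulo p. *)
rewrite (bigD1 (Ordinal (ltn_pmod (p.-1 * m) p_gt0))) //=.
by rewrite (GRing.natr_mod_pchar char_k) -oppr_nat_pchar addNr mul0r.
Qed.

End PrimeField.

(** * Powers of a derivation *)

Section BinomialIteration.
Variables (k : fieldType) (V : lmodType k) (D : {linear V -> V}).
Variable e : nat -> nat -> V.
Hypothesis De : forall i j, D (e i j) = e i.+1 j + e i j.+1.

(** The hypothesis on D says that D is the sum of two commuting shifts of the
    array e, whence the binomial coefficients. *)
Lemma iter_sum_shifts m :
  iter m D (e 0 0) = \sum_(i < m.+1) e i (m - i) *+ 'C(m, i).
Proof.
elim: m => [|m IHm]; first by rewrite big_ord1 bin0.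
rewrite iterS IHm linear_sum /=.
under eq_bigr => i _ do rewrite linearMn De mulrnDl.
rewrite big_split /= [RHS]big_ord_recl /= bin0.
under [X in _ = _ + X]eq_bigr => i _ do rewrite binS mulrnDr.
rewrite big_split /= addrA addrC; congr (_ + _).
rewrite big_ord_recl [in RHS]big_ord_recr /= bin0 !subn0 (@bin_small m m.+1) //.
rewrite mulr0n addr0; congr (_ + _); apply: eq_bigr => i _.
by rewrite /bump /= add1n subSS -subSn.
Qed.

(** The inner binomial coefficients are divisible by p. *)
Lemma iter_sum_shifts_pchar p : p \in [pchar k] ->
  iter p D (e 0 0) = e p 0 + e 0 p.
Proof.
move=> char_k; have p_pr := pcharf_prime char_k.
case: p p_pr char_k => // p p_pr char_k.
rewrite iter_sum_shifts big_ord_recr big_ord_recl /= bin0 binn subnn subn0 addrC.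
congr (_ + _); rewrite big1 ?addr0 // => i _; rewrite -scaler_nat /bump /= add1n.
have /dvdnP[q ->] : (p.+1 %| 'C(p.+1, i.+1))%N by rewrite prime_dvd_bin ?ltnS /=.
by rewrite natrM (pcharf0 char_k) mulr0 scale0r.
Qed.

End BinomialIteration.

Section Derivation.
Variables (k : fieldType) (A : algType k) (D : {linear A -> A}).
Hypothesis D_leibniz : forall u v, D (u * v) = D u * v + u * D v.

Lemma derivation_scalar (c : k) : D c%:A = 0.
Proof.
have D1 : D 1 = 0.
  by apply: (addrI (D 1)); have := D_leibniz 1 1; rewrite !mul1r mulr1 addr0 => <-.
by rewrite linearZ /= D1 scaler0.
Qed.

Lemma derivation_expr y m : D y = y ^+ 2 -> D (y ^+ m) = m%:R *: y ^+ m.+1.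
Proof.
move=> Dy; elim: m => [|m IHm].
  by rewrite expr0 scale0r -[1]scale1r derivation_scalar.
rewrite exprS D_leibniz Dy IHm -scalerAr -exprD -exprS.
by rewrite -[X in X + _]scale1r -scalerDl -mulrS.
Qed.

Variable p : nat.
Hypothesis char_k : p \in [pchar k].

(** The array of the products (D^i u) (D^j v) is shifted by the Leibniz rule. *)
Lemma iter_derivation_leibniz u v :
  iter p D (u * v) = iter p D u * v + u * iter p D v.
Proof.
pose e i j := iter i D u * iter j D v.
by rewrite -(@iter_sum_shifts_pchar _ _ D e) // => i j; rewrite /e D_leibniz.
Qed.

Lemma derivation_eigen y w (b c : k) i j :
    D y = y ^+ 2 -> D w = b *: (y * w) + c *: (w * y) ->
  D (y ^+ i * w * y ^+ j) = (i%:R + b) *: (y ^+ i.+1 * w * y ^+ j)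
                          + (j%:R + c) *: (y ^+ i * w * y ^+ j.+1).
Proof.
move=> Dy Dw; rewrite !D_leibniz !(derivation_expr _ Dy) Dw.
rewrite mulrDr -!scalerAr !mulrA -exprSr !mulrDl -!scalerAl.
by rewrite -[_ * y * y ^+ j]mulrA -exprS !scalerDl -!addrA [c *: _ + _]addrC.
Qed.

(** By [derivation_eigen], D multiplies y^i w y^j by (i + b) y on the left plus
    (j + c) y on the right; the partial products of these coefficients turn D
    into a sum of two shifts. *)
Lemma iter_derivation_eigen y w (b c : k) :
    D y = y ^+ 2 -> D w = b *: (y * w) + c *: (w * y) ->
  iter p D w = (\prod_(j < p) (j%:R + b)) *: (y ^+ p * w)
             + (\prod_(j < p) (j%:R + c)) *: (w * y ^+ p).
Proof.
move=> Dy Dw.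
pose e i j := (\prod_(l < i) (l%:R + b) * \prod_(l < j) (l%:R + c))
                *: (y ^+ i * w * y ^+ j).
have e00 : e 0%N 0%N = w by rewrite /e !big_ord0 !expr0 !mulr1 mul1r scale1r.
have De i j : D (e i j) = e i.+1 j + e i j.+1.
  rewrite /e linearZ /= (derivation_eigen _ _ Dy Dw) scalerDr !scalerA.
  by rewrite !big_ord_recr /= mulrAC mulrA.
rewrite -[X in iter p D X]e00 (iter_sum_shifts_pchar De char_k) /e.
by rewrite !big_ord0 !expr0 !mulr1 !mul1r.
Qed.

End Derivation.

(** * The nilHecke algebra *)

(** The scalar term of D d contributes a x to D (x d), and x d = d y + 1 turns
    a x into a (x^2 d - x d y): it cancels the remaining multiple of x^2 d, and
    only y (x d) and (x d) y are left. *)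
Lemma nh_der_xdelta (k : fieldType) (A : algType k) (a : k) (x y d : A) :
    y * x = x * y -> d * y = x * d - 1 ->
  x ^+ 2 * d + x * (a%:A - (a + 1) *: (x * d) + (a - 1) *: (y * d)) =
  (a - 1) *: (y * (x * d)) + (- a) *: (x * d * y).
Proof.
move=> yx dy; rewrite -[x * d * y]mulrA dy [y * (x * d)]mulrA yx expr2.
rewrite !mulrDr !mulrN -!scalerAr !mulrA mulr1 !scalerDl !scaleN1r !scale1r.
rewrite !scaleNr !scalerDr !scalerN.
zmod_eq.
Qed.

Section DividedDifferenceAction.
Variables (k L : fieldType) (iota : {rmorphism k -> L}) (n : nat).
Implicit Types (u v : nilHecke k n) (f : ('I_n -> L) -> L).

(** Equal elements of the algebra may be represented by different expressions,
    and these act alike only at points with distinct coordinates; so the action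
    of an element is studied at such points. *)
Definition nh_act u f (z : 'I_n -> L) : L := dd_act iota (repr u) f z.

Variable z : 'I_n -> L.
Hypothesis z_inj : injective z.

Lemma nh_act_class e f : nh_act (alg_class _ e) f z = dd_act iota e f z.
Proof. exact: (dd_act_cong iota (cong_repr _ e) f z_inj). Qed.

Lemma nh_act0 f : nh_act 0 f z = 0.
Proof. by rewrite nh_act_class /= rmorph0 mul0r. Qed.

Lemma nh_actD u v f : nh_act (u + v) f z = nh_act u f z + nh_act v f z.
Proof. exact: nh_act_class. Qed.

Lemma nh_actZ c u f : nh_act (c *: u) f z = iota c * nh_act u f z.
Proof. exact: nh_act_class. Qed.

Lemma nh_actM u v f : nh_act (u * v) f z = nh_act u (nh_act v f) z.
Proof. exact: nh_act_class. Qed.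

Lemma nh_act_x i f : nh_act (nh_x i) f z = z i * f z.
Proof. exact: nh_act_class. Qed.

Lemma nh_act_delta i f : nh_act (nh_delta i) f z =
  (f z - f (swap_strands i z)) / (z (lstrand i) - z (rstrand i)).
Proof. exact: nh_act_class. Qed.

Lemma nh_actXn i m f : nh_act (nh_x i ^+ m) f z = z i ^+ m * f z.
Proof.
elim: m f => [|m IHm] f; last by rewrite exprSr nh_actM IHm nh_act_x mulrA -exprSr.
rewrite !expr0 mul1r -[1]scale1r nh_actZ rmorph1 mul1r.
by rewrite /GRing.one /= nh_act_class /= rmorph1 mul1r.
Qed.

End DividedDifferenceAction.

(** On the constant function 1 the first summand acts by zero, since divided
    differences kill constants; the second one sends 1 to
    c x (y^m - x^m) / (x - y), which at a point with x <> 0 and x^m <> y^m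
    vanishes only if c = 0. *)
Lemma nh_xdeltaX_indep (k : fieldType) (n m : nat) (i : 'I_n.-1) (b c : k) :
  (0 < m)%N ->
  b *: (nh_x (rstrand i) ^+ m * (nh_x (lstrand i) * nh_delta i))
    + c *: (nh_x (lstrand i) * nh_delta i * nh_x (rstrand i) ^+ m)
    = 0 :> nilHecke k n ->
  c = 0.
Proof.
move=> m_gt0.
(* Coordinates that are powers of an indeterminate stay distinct, and nonzero,
   when raised to the m-th power. *)
pose iota : {rmorphism k -> {fraction {poly k}}} := @tofrac {poly k} \o polyC.
pose z (j : 'I_n) : {fraction {poly k}} := tofrac ('X^j : {poly k}).
have zX_inj q : (0 < q)%N -> injective (fun j => z j ^+ q).
  move=> q_gt0 j l /eqP; rewrite -!rmorphXn tofrac_eq -!exprM => /eqP.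
  move=> /(congr1 (fun r : {poly k} => size r)); rewrite !size_polyXn => -[] /eqP.
  by rewrite eqn_pmul2r // => /eqP/val_inj.
have z_inj : injective z by move=> j l zjl; apply: (zX_inj 1%N).
have z_neq0 j : z j != 0 by rewrite tofrac_eq0 -size_poly_eq0 size_polyXn.
have s_inj := swap_strands_inj (j := i) z_inj.
have w_act f : nh_act iota (nh_x (lstrand i) * nh_delta i) f z = z (lstrand i) *
    ((f z - f (swap_strands i z)) / (z (lstrand i) - z (rstrand i))).
  by rewrite nh_actM // nh_act_x // nh_act_delta.
move=> /(congr1 (fun u => nh_act iota u (fun=> 1) z)).
rewrite nh_act0 // nh_actD // !nh_actZ // nh_actM // nh_actXn // w_act.
rewrite subrr mul0r !mulr0 add0r nh_actM // w_act !nh_actXn // !mulr1 swap_strands_r.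
move=> /eqP; rewrite !mulf_eq0 invr_eq0 (negPf (z_neq0 _)) !subr_eq0.
rewrite (inj_eq (zX_inj m m_gt0)) (inj_eq z_inj).
rewrite [rstrand i == _]eq_sym (negPf (lrstrand_neq i)).
by rewrite !orbF fmorph_eq0 => /eqP.
Qed.

Theorem lemma3p6 (k : fieldType) (p : nat) (char_k : p \in [pchar k])
  (n : nat) (n_ge2 : (2 <= n)%N) (a : k)
  (D : {linear nilHecke k n -> nilHecke k n})
  (D_leibniz : forall u v : nilHecke k n, D (u * v) = D u * v + u * D v)
  (D_x : forall i : 'I_n, D (nh_x i) = nh_x i ^+ 2)
  (D_delta : forall i : 'I_n.-1,
     D (nh_delta i) = a%:A - (a + 1) *: (nh_x (lstrand i) * nh_delta i)
                      + (a - 1) *: (nh_x (rstrand i) * nh_delta i)) :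
  (forall u : nilHecke k n, iter p D u = 0) <->
  (exists c : 'F_p, a = (c : nat)%:R).
Proof.
have p_gt0 : (0 < p)%N by rewrite prime_gt0 ?(pcharf_prime char_k).
have Dw i : D (nh_x (lstrand i) * nh_delta i) =
    (a - 1) *: (nh_x (rstrand i) * (nh_x (lstrand i) * nh_delta i))
      + (- a) *: (nh_x (lstrand i) * nh_delta i * nh_x (rstrand i)).
  rewrite D_leibniz D_x D_delta.
  apply: (@nh_der_xdelta k (nilHecke k n) a); [exact: nh_xx | exact: nh_delta_xr].
have Ew i := iter_derivation_eigen D_leibniz char_k (D_x (rstrand i)) (Dw i).
have E_mul := iter_derivation_leibniz D_leibniz char_k.
split=> [E0|/prime_subfieldP a_nat].
  have i : 'I_n.-1 by exists 0%N; rewrite -subn1 subn_gt0.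
  have := Ew i; rewrite E0 => /esym/(nh_xdeltaX_indep p_gt0)/(prod_natD_eq0 char_k).
  move=> [m Na]; apply/(prime_subfieldP char_k); exists (p.-1 * m)%N.
  by rewrite -oppr_nat_pchar // -Na opprK.
have [m aE] := a_nat char_k.
have prod0 (c : k) q : c = q%:R -> \prod_(j < p) (j%:R + c) = 0.
  by move=> cE; apply/(prod_natD_eq0 char_k); exists q.
have Ex i : iter p D (nh_x i) = 0.
  have Dxi : D (nh_x i) = 1 *: (nh_x i * nh_x i) + 0 *: (nh_x i * nh_x i).
    by rewrite scale1r scale0r addr0 D_x.
  rewrite (iter_derivation_eigen D_leibniz char_k (D_x i) Dxi).
  by rewrite (prod0 1 1%N) // (prod0 0 0%N) // !scale0r addr0.
have EZ c : iter p D c%:A = 0.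
  by rewrite -(prednK p_gt0) iterSr (derivation_scalar D_leibniz) iter_fix ?linear0.
have ED u v : iter p D (u + v) = iter p D u + iter p D v.
  by elim: (p) => // q IHq; rewrite !iterS IHq linearD.
have Ed i : iter p D (nh_delta i) = 0.
  pose x : nilHecke k n := nh_x (lstrand i).
  pose y : nilHecke k n := nh_x (rstrand i).
  pose d : nilHecke k n := nh_delta i; rewrite -/d.
  have Ew0 : iter p D (x * d) = 0.
    have aN1 : a - 1 = (m + p.-1)%:R.
      by rewrite aE natrD -[p.-1]muln1 -(oppr_nat_pchar char_k).
    have aN : - a = (p.-1 * m)%:R by rewrite aE (oppr_nat_pchar char_k).
    by rewrite Ew (prod0 _ _ aN1) (prod0 _ _ aN) !scale0r addr0.
  have dx : d * x = 1 + y * d by apply: nh_delta_xl.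
  have dd : d * d = 0 by apply: nh_delta2.
  have Edx : iter p D d * x = y * iter p D d.
    have := congr1 (iter p D) dx.
    by rewrite E_mul Ex mulr0 addr0 ED -(scale1r 1) EZ E_mul Ex mul0r !add0r.
  have dE : d = d * (x * d) by rewrite mulrA dx mulrDl mul1r -mulrA dd mulr0 addr0.
  (* Substituting this equation in its own right-hand side produces d * d. *)
  have EdE : iter p D d = y * (iter p D d * d).
    by rewrite [in LHS]dE E_mul Ew0 mulr0 addr0 mulrA Edx mulrA.
  by rewrite EdE [X in _ * (X * _)]EdE -!mulrA dd !mulr0.
elim/nilHecke_ind => [i|i|c|u v Eu Ev|u v Eu Ev] //.
- by rewrite ED Eu Ev addr0.
- by rewrite E_mul Eu Ev mul0r mulr0 addr0.
Qed.
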